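(* Let $p$ be an odd prime and let $r$ be a positive integer such that $p^r \ge 5$. Let $\mathcal{T}^* = \{1,\xi,\xi^2, \dots, \xi^{p^r-2}\}$ be the Teichmüller group of the Galois ring $\mathrm{GR}(p^2,r)$, and let $\mathcal{T} = \mathcal{T}^*\cup\{0\}$. Let $\mathcal{T}_S^* = \{1, \xi^2, \dots, \xi^{p^r-3}\}$ be the set of squares and $\mathcal{T}_N^* = \{\xi, \xi^3, \dots, \xi^{p^r-2}\}$ the set of non-squares in $\mathcal{T}^*$. Then the collection \[ E^H = \{(1+p\alpha)\mathcal{T}_S^*:\alpha \in \mathcal{T}\} \cup \{p\mathcal{T}_S^*\} \cup \{(1+p\alpha)\mathcal{T}_N^* : \alpha \in \mathcal{T}\} \cup \{p\mathcal{T}_N^*\} \] forms a near-complete $\left(p^{2r}, \frac{p^r-1}{2}, \frac{p^r-3}{2}\right)$ disjoint difference family in the additive group of $\mathrm{GR}(p^2,r)$.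
   Context: $\mathrm{GR}(p^2,r)$ is the Galois ring of characteristic $p^2$ and extension degree $r$, i.e. $\mathbb{Z}_{p^2}[x]/\langle f(x)\rangle$ with $f$ monic of degree $r$ whose reduction modulo $p$ is irreducible in $\mathbb{F}_p[x]$ (unique up to isomorphism, of order $p^{2r}$). Its Teichmüller group $\mathcal{T}^*$ is the cyclic subgroup of order $p^r-1$ of the unit group, and $\xi$ is a generator of it; $\mathcal{T}=\mathcal{T}^*\cup\{0\}$ is a system of representatives of $\mathrm{GR}(p^2,r)/p\,\mathrm{GR}(p^2,r)\cong\mathbb{F}_{p^r}$. For a subset $A$ of an additively written abelian group $G$, $\Delta A$ is the multiset $\{a-a' : a,a'\in A,\ a\neq a'\}$. Let $G$ be an abelian group of order $v$ and $D_1,\dots,D_b$ be $k$-subsets of $G$. The collection $D=\{D_1,\dots,D_b\}$ is a $(v,k,\lambda)$ difference family in $G$ if each nonzero element of $G$ occurs exactly $\lambda$ times in the multiset union $\bigcup_{i=1}^b \Delta D_i$. It is a disjoint difference family if the $D_i$ are mutually disjoint, and it is near-complete if $D_1,\dots,D_b$ partition $G\setminus\{0\}$. *)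

(* Defs.v *)
From HB Require Import structures.
From mathcomp Require Import all_boot all_order all_fingroup all_algebra.

Set Implicit Arguments.
Unset Strict Implicit.
Unset Printing Implicit Defensive.

Import GRing.Theory.
Local Open Scope ring_scope.

(* Multisets are sequences, with multiplicities given by count_mem. A collection
   of blocks is also a sequence, so a block may a priori be repeated. *)
Section DifferenceFamily.
Variable G : finZmodType.

Definition Delta (A : {set G}) : seq G :=
  [seq x.1 - x.2 | x <- enum (setX A A) & x.1 != x.2].

Definition difference_family (v k lambda : nat) (D : seq {set G}) : Prop :=
  [/\ #|G| = v,
      forall A : {set G}, A \in D -> #|A| = k
    & forall g : G, g != 0 ->
        count_mem g (flatten [seq Delta A | A <- D]) = lambda].

(* pairwise compares positions, so a nonempty block cannot be repeated. *)
Definition mutually_disjoint (D : seq {set G}) : bool :=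
  pairwise (fun A B : {set G} => [disjoint A & B]) D.

Definition disjoint_difference_family (v k lambda : nat) (D : seq {set G}) :
    Prop :=
  difference_family v k lambda D /\ mutually_disjoint D.

Definition near_complete (D : seq {set G}) : bool :=
  uniq D && partition [set:: D] [set~ 0].

End DifferenceFamily.

Section GaloisRing.
Variable p : nat.

Definition reduce_mod_p (a : 'Z_(p ^ 2)) : 'F_p := (nat_of_ord a)%:R.

Definition galois_poly (r : nat) (f : {poly 'Z_(p ^ 2)}) : Prop :=
  [/\ f \is monic, size f = r.+1 & irreducible_poly (map_poly reduce_mod_p f)].

(* GR(p^2, r), when galois_poly r f holds. That condition makes f monic of
   positive degree, without which {poly %/ f} is not the quotient by f. *)
Definition GR (f : {poly 'Z_(p ^ 2)}) := {poly %/ f}.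

HB.instance Definition _ f := GRing.ComNzRing.on (GR f).
HB.instance Definition _ f := Finite.on (GR f).

End GaloisRing.

(* xi is meant to be a primitive (q - 1)-th root of unity of GR(p^2, r), with
   q = p ^ r: the units of that ring have a unique subgroup of order q - 1,
   which is cyclic, and its generators are the elements of order q - 1. *)
Section Teichmuller.
Variables (R : finComNzRingType) (p q : nat) (xi : R).

Definition Tstar : {set R} := [set xi ^+ i | i : 'I_(q - 1)].
Definition Teich : {set R} := 0 |: Tstar.
Definition Tsquares : {set R} := [set xi ^+ (2 * i) | i : 'I_((q - 1) %/ 2)].
Definition Tnonsquares : {set R} :=
  [set xi ^+ (2 * i + 1) | i : 'I_((q - 1) %/ 2)].

Definition dilate (c : R) (A : {set R}) : {set R} := [set c * x | x in A].

Definition EH : seq {set R} :=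
  [seq dilate (1 + p%:R * alpha) Tsquares | alpha <- enum Teich]
  ++ [:: dilate p%:R Tsquares]
  ++ [seq dilate (1 + p%:R * alpha) Tnonsquares | alpha <- enum Teich]
  ++ [:: dilate p%:R Tnonsquares].

End Teichmuller.

(* Main.v *)
From HB Require Import structures.
Require Import Defs.
From mathcomp Require Import all_boot all_order all_fingroup all_algebra.
From mathcomp Require Import zify ring.
Import GRing.Theory.
Local Open Scope ring_scope.

Set Implicit Arguments.
Unset Strict Implicit.

(** Write q = p ^ r, R = GR(p^2, r) and H for the group of squares in the
    Teichmuller group, of order m = (q - 1) / 2.

    Every block is an orbit c H of H acting on R \ {0} by multiplication: the
    blocks built on non-squares are the orbits of (1 + p a) xi and p xi.  Two
    facts then give the theorem.

    First, distinct elements of H differ by a unit ([Teich_sep]).  Fix g <> 0.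
    A difference g inside a block is a pair (x, x h) with x <> 0, h in H,
    h <> 1 and g = x (1 - h); as 1 - h is a unit, x is determined by h.  So g
    occurs exactly m - 1 = (q - 3) / 2 times, whichever family of orbits
    partitions R \ {0} ([orbit_differences]).

    Second, the 2 (q + 1) listed orbits do partition R \ {0}.  There are
    2 (q + 1) m = q ^ 2 - 1 products c h with c a representative and h in H,
    as many as nonzero elements, so it is enough that the products reach every
    nonzero element ([dilates_partition]).  Each element of R is a + p b with a
    and b in the Teichmuller set ([Teich_decomp]); if a = 0 it is p b, and
    otherwise it is (1 + p b / a) a ([EH_covers]).

    All this rests on four properties of R: p ^ 2 = 0, p <> 0, #|R| = q ^ 2,
    and every element outside p R is a unit.  The last one comes from a Bezout
    identity over F_p, lifted modulo p ([qpoly_local]). *)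

(** * Quotients of polynomial rings by a lifted irreducible polynomial *)

Lemma map_poly_surj (A K : nzRingType) (phi : {rmorphism A -> K}) :
  (forall k, exists a, phi a = k) ->
  forall u : {poly K}, exists U : {poly A}, map_poly phi U = u.
Proof.
move=> phi_surj; elim/poly_ind=> [|u c [U <-]].
  by exists 0; rewrite rmorph0.
have [a <-] := phi_surj c.
by exists (U * 'X + a%:P); rewrite rmorphD rmorphM /= map_polyX map_polyC.
Qed.

Lemma map_poly_ker (A K : nzRingType) (phi : {rmorphism A -> K}) (pi : A) :
  (forall a, phi a = 0 -> exists b, a = pi * b) ->
  forall u : {poly A}, map_poly phi u = 0 -> exists v, u = pi%:P * v.
Proof.
move=> phi_ker; elim/poly_ind=> [|u c IHu].
  by exists 0; rewrite mulr0.
move=> /polyP uc0.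
have [b ->]: exists b, c = pi * b.
  apply: phi_ker; move: (uc0 0).
  by rewrite coef_map coefD coefMX coefC add0r coef0.
have [|v ->] := IHu.
  apply/polyP=> i; move: (uc0 i.+1).
  by rewrite !coef_map coefD coefMX coefC /= addr0 !coef0.
by exists (v * 'X + b%:P); rewrite mulrDr mulrA polyCM.
Qed.

(** If x does not vanish over K, it is coprime to f there because f is
    irreducible and of larger size.  A Bezout identity u x + v f = 1 over K
    lifts to U x = 1 + pi w in the quotient, and 1 + pi w has inverse 1 - pi w
    since pi squares to zero. *)
Lemma qpoly_local (A : comNzRingType) (K : fieldType)
    (phi : {rmorphism A -> K}) (pi : A) (f : {poly A}) :
  pi * pi = 0 -> (forall k, exists a, phi a = k) ->
  (forall a, phi a = 0 -> exists b, a = pi * b) ->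
  f \is monic -> irreducible_poly (map_poly phi f) ->
  forall x : {poly %/ f},
    (exists y, x = in_qpoly f pi%:P * y) \/ (exists y, x * y = 1).
Proof.
move=> pi2 phi_surj phi_ker f_monic f_irr x.
have size_phif : size (map_poly phi f) = size f.
  by rewrite size_map_poly_id0 // (monicP f_monic) rmorph1 oner_eq0.
have f_gt1 : (1 < size f)%N by rewrite -size_phif; case: f_irr.
have mkf : mk_monic f = f by rewrite /mk_monic f_gt1 f_monic.
have x_small : (size (x : {poly A}) < size f)%N
  by apply: leq_trans (size_mk_monic x) _; rewrite mkf.
have xE : x = in_qpoly f x
  by apply/val_inj/esym/in_qpoly_small/size_mk_monic.
have [phix0 | phix_neq0] := eqVneq (map_poly phi x) 0.
  have [v xv] := map_poly_ker phi_ker phix0.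
  by left; exists (in_qpoly f v); rewrite -rmorphM -xv.
have cop : coprimep (map_poly phi x) (map_poly phi f).
  rewrite coprimep_def; apply: contraT => gcd_neq1.
  have := f_irr.2 _ gcd_neq1 (dvdp_gcdr _ _).
  rewrite /eqp => /andP[_ /dvdp_trans/(_ (dvdp_gcdl _ _))/(dvdp_leq phix_neq0)].
  by rewrite size_phif leqNgt (leq_ltn_trans (size_poly _ _) x_small).
have /Bezout_eq1_coprimepP[[u v] /= uv1] := cop.
have [U Uu] := map_poly_surj phi_surj u.
have [V Vv] := map_poly_surj phi_surj v.
have [|W UVW] := map_poly_ker (u := U * x + V * f - 1) phi_ker.
  by rewrite rmorphB rmorphD !rmorphM rmorph1 /= Uu Vv uv1 subrr.
have f0 : in_qpoly f f = 0.
  by apply: val_inj; rewrite /= mkf Pdiv.RingMonic.rmodpp.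
have /(congr1 (in_qpoly f)) := UVW.
rewrite rmorphB rmorphD !rmorphM rmorph1 /= f0 mulr0 addr0 -xE.
set P := in_qpoly f pi%:P; set w := in_qpoly f W => Ux.
have P2 : P * P = 0 by rewrite -rmorphM -polyCM pi2 rmorph0.
right; exists (in_qpoly f U * (1 - P * w)).
rewrite mulrA [x * _]mulrC.
move/eqP: Ux; rewrite subr_eq => /eqP->.
have -> : (P * w + 1) * (1 - P * w) = 1 - P * P * (w * w) by ring.
by rewrite P2 mul0r subr0.
Qed.

(** * The Galois ring *)

Section GaloisRingFacts.
Context (p r : nat) (f : {poly 'Z_(p ^ 2)}).
Hypotheses (p_pr : prime p) (r_gt0 : (0 < r)%N) (f_gal : galois_poly r f).

Let p2_gt1 : (1 < p ^ 2)%N.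
Proof. by rewrite (ltn_exp2l 0) ?prime_gt1. Qed.

Lemma reduce_mod_p_nat n : reduce_mod_p (n%:R : 'Z_(p ^ 2)) = n%:R.
Proof.
rewrite /reduce_mod_p val_Zp_nat // -(Fp_nat_mod p_pr) modn_dvdm ?Fp_nat_mod //.
exact: dvdn_mulr.
Qed.

Fact reduce_mod_p_zmod_morphism : zmod_morphism (@reduce_mod_p p).
Proof.
move=> a b; rewrite -[a]natr_Zp -[b]natr_Zp.
apply/eqP; rewrite eq_sym subr_eq; apply/eqP.
rewrite -{1}[a%:R](subrK b%:R) -[_ - _]natr_Zp.
by rewrite -natrD !reduce_mod_p_nat natrD.
Qed.

Fact reduce_mod_p_monoid_morphism : monoid_morphism (@reduce_mod_p p).
Proof.
split=> [|a b]; first exact: (reduce_mod_p_nat 1).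
by rewrite -[a]natr_Zp -[b]natr_Zp -natrM !reduce_mod_p_nat natrM.
Qed.

Lemma GR_local (x : GR f) :
  (exists y, x = p%:R * y) \/ (exists y, x * y = 1).
Proof.
case: f_gal => f_monic _ f_irr.
pose phi : {rmorphism 'Z_(p ^ 2) -> 'F_p} :=
  HB.pack (@reduce_mod_p p)
    (GRing.isZmodMorphism.Build _ _ _ reduce_mod_p_zmod_morphism)
    (GRing.isMonoidMorphism.Build _ _ _ reduce_mod_p_monoid_morphism).
have := @qpoly_local _ _ phi p%:R f _ _ _ f_monic f_irr x.
rewrite polyC_natr rmorph_nat; apply.
- by rewrite -natrM mulnn pchar_Zp.
- by move=> k; exists k%:R; rewrite /phi /= reduce_mod_p_nat natr_Zp.
- move=> a; rewrite /phi /= /reduce_mod_p => a0.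
  have /dvdnP[k ak] : (p %| nat_of_ord a)%N.
    by rewrite (dvdn_pcharf (pchar_Fp p_pr)) a0.
  by exists k%:R; rewrite -natrM mulnC -ak natr_Zp.
Qed.

Lemma GR_sqr_p : p%:R * p%:R = 0 :> GR f.
Proof.
rewrite -natrM mulnn.
suff -> : (p ^ 2)%:R = in_qpoly f (p ^ 2)%:R%:P.
  by rewrite pchar_Zp // rmorph0.
by rewrite polyC_natr rmorph_nat.
Qed.

Lemma GR_p_neq0 : p%:R != 0 :> GR f.
Proof.
apply/eqP => /(congr1 val) /=; rewrite qpolyC_natr -polyC_natr.
move/(congr1 (fun u : {poly _} => u`_0)); rewrite coefC coef0 /=.
move/(congr1 val); rewrite /= val_Zp_nat // modn_small.
  by move=> p0; move: p_pr; rewrite p0.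
by rewrite -{1}[p]expn1 ltn_exp2l ?prime_gt1.
Qed.

Lemma card_GR : #|GR f| = ((p ^ r) * (p ^ r))%N.
Proof.
case: f_gal => f_monic f_size _.
rewrite card_monic_qpoly ?f_size ?ltnS // card_ord Zp_cast //=.
by rewrite -expnMn mulnn.
Qed.
End GaloisRingFacts.

(** * Difference families made of orbits *)

Section OrbitBlocks.
Variables (R : finComNzRingType) (H : {set R}).

Lemma card_dilate c : {in H &, injective (fun h => c * h)} ->
  #|dilate c H| = #|H|.
Proof. exact: card_in_imset. Qed.

(** As g is nonzero, x - y = g forces x <> y, so the pairs with difference g
    correspond to their first components x. *)
Lemma count_Delta (A : {set R}) (g : R) : g != 0 ->
  count_mem g (Delta A) = (\sum_(x in A) ((x - g)%R \in A))%N.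
Proof.
move=> g0; rewrite /Delta count_map count_filter -sum1_count big_enum_cond /=.
pose Q x y := (y == x - g) && (x - g \in A).
rewrite (eq_bigl (fun x => (x.1 \in A) && Q x.1 x.2)) /Q.
  rewrite -(pair_big_dep (mem A) Q (fun _ _ => 1%N)) /Q /=.
  apply: eq_bigr => x _; case: (x - g \in A).
    by rewrite (eq_bigl (pred1 (x - g))) ?big_pred1_eq // => y; rewrite andbT.
  by rewrite big1 // => y; rewrite andbF.
case=> x y; rewrite !inE /= -andbA; congr (_ && _).
have -> : (x - y == g) = (y == x - g).
  by rewrite subr_eq addrC -subr_eq eq_sym.
have [->|_] := eqVneq y (x - g); last by rewrite /= andbF.
rewrite /= -subr_eq0 opprB addrCA subrr addr0.
by rewrite g0 andbT.
Qed.

Hypothesis H1 : 1 \in H.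
(* Together with 1 in H, this makes H a group: k h = 1 is solvable in H. *)
Hypothesis H_stable : {in H, forall h, dilate h H = H}.
Hypothesis H_sep :
  {in H &, forall h k : R, h != k -> exists y : R, (h - k) * y = 1}.

Lemma dilate_orbit c x : x \in dilate c H -> dilate c H = dilate x H.
Proof.
case/imsetP=> h hH ->; rewrite -{1}(H_stable hH) /dilate -imset_comp.
by apply: eq_imset => k /=; rewrite mulrA.
Qed.

Lemma sep_eq0 x h k : h \in H -> k \in H -> h != k -> x * h = x * k -> x = 0.
Proof.
move=> hH kH /(H_sep hH kH)[y hky] /eqP; rewrite -subr_eq0 -mulrBr => /eqP xhk.
by rewrite -[x]mulr1 -hky mulrA xhk mul0r.
Qed.

(** The elements x counted here are the g / (1 - h) for h in H different
    from 1: the pair (x, x - g) lies in an orbit when x - g = x h. *)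
Lemma card_orbit_differences (g : R) : g != 0 ->
  #|[set x | (x != 0) && (x - g \in dilate x H)]| = (#|H| - 1)%N.
Proof.
(* v h is the inverse of 1 - h. *)
move=> g0; pose v (h : R) : R := odflt 0 [pick y : R | (1 - h) * y == 1].
have vP h : h \in H :\ 1 -> (1 - h) * v h = 1.
  rewrite !inE eq_sym => /andP[h1 hH]; rewrite /v; case: pickP => [y /eqP//|].
  by have [y yE] := H_sep H1 hH h1; move/(_ y); rewrite yE eqxx.
have gvE h : h \in H :\ 1 -> g * v h * h = g * v h - g.
  move=> hH; have -> : g * v h * h = g * v h - g * ((1 - h) * v h) by ring.
  by rewrite vP ?mulr1.
have -> : [set x | (x != 0) && (x - g \in dilate x H)]
            = [set g * v h | h in H :\ 1].
  apply/setP=> x; rewrite inE.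
  apply/andP/imsetP=> [[x0 /imsetP[h hH xg]]|[h hH ->]].
    have gE : g = x * (1 - h) by rewrite mulrBr mulr1 -xg opprB addrC subrK.
    have hH1 : h \in H :\ 1.
      rewrite !inE hH andbT; apply: contraNneq g0 => h1.
      by rewrite gE h1 subrr mulr0.
    by exists h => //; rewrite gE -mulrA vP ?mulr1.
  split; last first.
    by rewrite -gvE //; apply: imset_f; case/setD1P: hH.
  apply: contraNneq g0 => gv0; have := gvE h hH.
  by rewrite gv0 mul0r sub0r => /eqP; rewrite eq_sym oppr_eq0.
rewrite card_in_imset => [|h k hH kH gvhk].
  by rewrite [#|H|](cardsD1 1) H1 addKn.
have [hH' kH'] : h \in H /\ k \in H by case/setD1P: hH; case/setD1P: kH.
apply: contraNeq g0 => hk.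
have gv0 : g * v h = 0.
  by apply: sep_eq0 hH' kH' hk _; rewrite gvE // gvhk gvE.
by have := gvE h hH; rewrite gv0 mul0r sub0r => /eqP; rewrite eq_sym oppr_eq0.
Qed.

(** The block containing x is the orbit of x, so the sum over all blocks of the
    number of x with x - g in the same block no longer mentions the blocks. *)
Lemma orbit_differences (D : seq {set R}) :
  (forall A, A \in D -> exists c, A = dilate c H) -> near_complete D ->
  forall g : R, g != 0 ->
    count_mem g (flatten [seq Delta A | A <- D]) = (#|H| - 1)%N.
Proof.
move=> D_orbit /andP[D_uniq /and3P[/eqP D_cover D_triv _]] g g0.
rewrite count_flatten -map_comp sumnE big_map.
transitivity (\sum_(A in [set:: D]) \sum_(x in A) ((x - g)%R \in dilate x H))%N.
  rewrite [RHS](eq_bigl [in D]) => [|A]; last by rewrite inE.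
  rewrite -big_uniq //=; apply: eq_big_seq => A /D_orbit[c Ac].
  rewrite count_Delta //; apply: eq_bigr => x; rewrite {1 2}Ac => xA.
  by rewrite (dilate_orbit xA).
rewrite -big_trivIset // D_cover -(card_orbit_differences g0) -sum1_card.
rewrite big_mkcond [RHS]big_mkcond /=; apply: eq_bigr => x _; rewrite !inE.
by case: (x == 0) => //=; case: (_ \in _).
Qed.
End OrbitBlocks.

(** The products c * h are as many as the nonzero elements and reach all of
    them, hence are pairwise distinct.  Distinctness inside one block gives its
    cardinal, distinctness between blocks gives disjointness, and every product
    is nonzero. *)
Lemma dilates_partition (R : finComNzRingType) (H : {set R}) (reps : seq R) :
  (0 < #|H|)%N -> (size reps * #|H| = #|R| - 1)%N ->
  (forall x : R, x != 0 -> exists2 c, c \in reps & x \in dilate c H) ->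
  let D := [seq dilate c H | c <- reps] in
  [/\ forall A : {set R}, A \in D -> #|A| = #|H|, mutually_disjoint D
    & near_complete D].
Proof.
move=> H_gt0 size_reps covers D.
pose L := [seq c * h | c <- reps, h <- enum H].
have sub : {subset enum [set~ (0 : R)] <= L}.
  move=> x; rewrite mem_enum !inE => /covers[c creps /imsetP[h hH ->]].
  by apply: allpairs_f; rewrite ?mem_enum.
have sizeL : (size L <= size (enum [set~ 0%R : R]))%N.
  by rewrite size_allpairs -!cardE size_reps cardsC1 subn1.
have L_uniq := leq_size_uniq (enum_uniq _) sub sizeL.
have [_ memL] := uniq_min_size (enum_uniq _) sub sizeL.
have [D_card D_disj] : (forall A : {set R}, A \in D -> #|A| = #|H|)
    /\ mutually_disjoint D.
  rewrite /D /mutually_disjoint; move: L_uniq; rewrite /L.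
  elim: (reps) => [|c s IHs] //=.
  rewrite cat_uniq => /and3P[cH_uniq cH_disj /IHs[s_card s_disj]]; split.
    move=> A; rewrite inE => /predU1P[->|/s_card//].
    by apply: card_dilate; apply/dinjectiveP.
  rewrite s_disj andbT; apply/allP=> A /mapP[d ds ->].
  rewrite -setI_eq0; apply: contraNT cH_disj => /set0Pn[x /setIP[xc xd]].
  apply/hasP; exists x.
    by case/imsetP: xd => h hH ->; apply: allpairs_f; rewrite ?mem_enum.
  by case/imsetP: xc => h hH ->; apply: map_f; rewrite mem_enum.
have D_neq0 A : A \in D -> A != set0.
  by move=> AD; rewrite -card_gt0 D_card.
have D_uniq : uniq D.
  rewrite uniq_pairwise; apply: (sub_in_pairwise (P := [in D])) D_disj.
    2: exact/allP.
  move=> A B AD BD /=; apply: contraTN => /eqP->.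
  by rewrite -setI_eq0 setIid; apply: D_neq0.
split=> //; rewrite /near_complete D_uniq /=; apply/and3P; split.
- apply/eqP/setP=> x; rewrite !inE.
  have -> : (x != 0) = (x \in L) by rewrite -memL mem_enum !inE.
  apply/bigcupP/allpairsP=> [[A]|[[c h] /= [creps hH ->]]].
    rewrite inE => /mapP[c creps ->] /imsetP[h hH ->].
    by exists (c, h); split; rewrite ?mem_enum.
  exists (dilate c H); first by rewrite inE; apply: map_f.
  by apply: imset_f; rewrite -mem_enum.
- apply/trivIsetP=> A B; rewrite !inE => AD BD AB.
  (* Adding the diagonal makes the relation reflexive, so that it holds for
     all pairs of blocks and not only for increasing positions. *)
  pose disj (X Y : {set R}) := (X == Y) || [disjoint X & Y].
  have : pairwise disj D.
    by apply: sub_pairwise D_disj => X Y; rewrite /disj => ->; rewrite orbT.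
  rewrite pairwise_all2rel; last 2 first.
  + by move=> X; rewrite /disj eqxx.
  + by move=> X Y; rewrite /disj eq_sym disjoint_sym.
  by move/allrelP/(_ A B AD BD); rewrite /disj (negPf AB).
- by rewrite inE; apply/negP => /D_neq0; rewrite eqxx.
Qed.

(** * The Teichmuller group *)

Lemma exprD_sqr0 (R : comNzRingType) (b z : R) n :
  z * z = 0 -> (b + z) ^+ n.+1 = b ^+ n.+1 + n.+1%:R * (b ^+ n * z).
Proof.
move=> z2; elim: n => [|n IHn]; first by rewrite !expr1 expr0 !mul1r.
rewrite exprS {}IHn [n.+2%:R]mulrS [b ^+ n.+2]exprS [b ^+ n.+1]exprS.
have -> : (b + z) * (b * b ^+ n + n.+1%:R * (b ^+ n * z)) =
  b * (b * b ^+ n) + (1 + n.+1%:R) * (b * b ^+ n * z)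
    + n.+1%:R * b ^+ n * (z * z).
  by ring.
by rewrite z2 mulr0 addr0.
Qed.

Section TeichmullerSystem.
Context (p r : nat) (R : finComNzRingType) (xi : R).
Local Notation q := (p ^ r)%N.
Local Notation m := ((q - 1) %/ 2)%N.
Hypotheses (p_odd : odd p) (r_gt0 : (0 < r)%N) (q_ge5 : (5 <= q)%N).
Hypotheses (p_sqr0 : p%:R * p%:R = 0 :> R) (p_neq0 : p%:R != 0 :> R).
Hypothesis R_card : #|R| = (q * q)%N.
Hypothesis R_local :
  forall x : R, (exists y, x = p%:R * y) \/ (exists y, x * y = 1).
Hypothesis xi_prim : (q - 1).-primitive_root xi.

Let q1E : (q - 1 = 2 * m)%N.
Proof.
have : odd q by rewrite oddX p_odd orbT.
by lia.
Qed.

Lemma Teich_expr i : xi ^+ i \in Teich q xi.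
Proof.
rewrite !inE; apply/orP; right; rewrite -(prim_expr_mod xi_prim).
have lt : (i %% (q - 1) < q - 1)%N by rewrite ltn_mod; lia.
exact: imset_f (Ordinal lt) _.
Qed.

Lemma TeichP a : a \in Teich q xi -> a = 0 \/ exists i, a = xi ^+ i.
Proof.
by rewrite !inE => /predU1P[|/imsetP[i _]]; [left | right; exists i].
Qed.

Lemma xi_inv i : exists j, xi ^+ i * xi ^+ j = 1.
Proof.
exists ((q - 2) * i)%N; rewrite -exprD (_ : (i + (q - 2) * i = (q - 1) * i)%N).
  by rewrite exprM (prim_expr_order xi_prim) expr1n.
by rewrite -mulSn; congr (_ * _)%N; lia.
Qed.

Lemma TeichM a b :
  a \in Teich q xi -> b \in Teich q xi -> a * b \in Teich q xi.
Proof.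
case/TeichP=> [->|[i ->]]; first by rewrite mul0r !inE eqxx.
case/TeichP=> [->|[j ->]]; first by rewrite mulr0 !inE eqxx.
by rewrite -exprD Teich_expr.
Qed.

Lemma Teich_expq a : a \in Teich q xi -> a ^+ q = a.
Proof.
have q_gt0 : (0 < q)%N by lia.
case/TeichP=> [->|[i ->]]; first by rewrite expr0n gtn_eqF.
rewrite -exprM (_ : i * q = (q - 1) * i + i)%N.
  by rewrite exprD exprM (prim_expr_order xi_prim) expr1n mul1r.
by rewrite mulnBl mul1n subnK ?leq_pmull // mulnC.
Qed.

(** Elements of the Teichmuller set are fixed by the q-th power map, and that
    map only depends on the class modulo p: (b + p y) ^ q = b ^ q, since the
    linear term carries the factor q p = 0 and all later terms the factor
    p ^ 2 = 0. *)
Lemma Teich_modp_inj a b y :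
  a \in Teich q xi -> b \in Teich q xi -> a = b + p%:R * y -> a = b.
Proof.
move=> aT bT ab; rewrite -(Teich_expq aT) -(Teich_expq bT) ab.
have -> : q = q.-1.+1 by lia.
have q0 : q%:R * p%:R = 0 :> R.
  by rewrite -(prednK r_gt0) expnS natrM mulrAC p_sqr0 mul0r.
rewrite exprD_sqr0; last by rewrite mulrACA p_sqr0 mul0r.
have -> : q.-1.+1 = q by lia.
by rewrite mulrCA [q%:R * _]mulrA q0 mul0r mulr0 addr0.
Qed.

Lemma Teich_sep a b : a \in Teich q xi -> b \in Teich q xi -> a != b ->
  exists y, (a - b) * y = 1.
Proof.
move=> aT bT ab; case: (R_local (a - b)) => // -[y /eqP].
rewrite subr_eq addrC => /eqP aby.
by case/eqP: ab; apply: Teich_modp_inj aby.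
Qed.

Lemma p_cancel_Teich a b : a \in Teich q xi -> b \in Teich q xi ->
  p%:R * a = p%:R * b -> a = b.
Proof.
move=> aT bT pab; apply: contraNeq p_neq0 => /(Teich_sep aT bT)[y aby].
by rewrite -[p%:R]mulr1 -[X in _ * X]aby mulrA mulrBr pab subrr mul0r.
Qed.

Lemma card_Teich : #|Teich q xi| = q.
Proof.
rewrite /Teich cardsU1 card_in_imset => [|i j _ _ /eqP].
  rewrite card_ord (_ : 0 \notin _) /=; first by lia.
  apply/imsetP=> -[i _ xi0]; have [j] := xi_inv i.
  by rewrite -xi0 mul0r => /eqP; rewrite eq_sym oner_eq0.
rewrite (eq_prim_root_expr xi_prim) !modn_small // => /eqP.
exact: val_inj.
Qed.

(** The q ^ 2 pairs (a, b) give distinct elements a + p b, and R has q ^ 2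
    elements. *)
Lemma Teich_decomp x : exists a b,
  [/\ a \in Teich q xi, b \in Teich q xi & x = a + p%:R * b].
Proof.
pose T := Teich q xi; pose dec (ab : R * R) := ab.1 + p%:R * ab.2.
have dec_inj : {in setX T T &, injective dec}.
  move=> [a b] [c d]; rewrite !in_setX /dec.
  move=> /andP[/= aT bT] /andP[/= cT dT] e.
  have ac : a = c.
    apply: (@Teich_modp_inj _ _ (d - b)) => //.
    by rewrite mulrBr addrA -e addrK.
  by rewrite ac in e *; rewrite (p_cancel_Teich bT dT (addrI _ e)).
have dec_surj : dec @: setX T T = setT.
  apply/eqP; rewrite eqEcard subsetT /= card_in_imset // cardsX card_Teich.
  by rewrite cardsT R_card.
have: x \in dec @: setX T T by rewrite dec_surj inE.
by case/imsetP=> -[a b]; rewrite in_setX => /andP[/= aT bT] ->; exists a, b.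
Qed.

Lemma Tsquares_expr i : xi ^+ (2 * i) \in Tsquares q xi.
Proof.
rewrite -(prim_expr_mod xi_prim) q1E -muln_modr.
have lt : (i %% m < m)%N by rewrite ltn_mod; lia.
exact: imset_f (Ordinal lt) _.
Qed.

Lemma Tsquares1 : 1 \in Tsquares q xi.
Proof. exact: (Tsquares_expr 0). Qed.

Lemma Tsquares_Teich h : h \in Tsquares q xi -> h \in Teich q xi.
Proof. by case/imsetP=> i _ ->; apply: Teich_expr. Qed.

Lemma card_Tsquares : #|Tsquares q xi| = m.
Proof.
have double_lt (k : 'I_m) : (2 * k < q - 1)%N.
  by rewrite [ltnRHS]q1E ltn_pmul2l.
rewrite card_in_imset ?card_ord // => i j _ _ /eqP.
rewrite (eq_prim_root_expr xi_prim) !modn_small //.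
by rewrite eqn_pmul2l // => /eqP/val_inj.
Qed.

Lemma dilate_Tsquares h :
  h \in Tsquares q xi -> dilate h (Tsquares q xi) = Tsquares q xi.
Proof.
case/imsetP=> i _ ->; apply/eqP; rewrite eqEcard; apply/andP; split.
  apply/subsetP=> x /imsetP[_ /imsetP[j _ ->] ->].
  by rewrite -exprD -mulnDr Tsquares_expr.
rewrite card_dilate // => a b _ _ /= ab.
have [j xij] := xi_inv (2 * i).
by rewrite -[a]mul1r -[b]mul1r -xij mulrAC ab mulrAC.
Qed.

Lemma dilate_Tnonsquares c :
  dilate c (Tnonsquares q xi) = dilate (c * xi) (Tsquares q xi).
Proof.
rewrite /dilate /Tnonsquares /Tsquares -!imset_comp; apply: eq_imset => i /=.
by rewrite addn1 exprS mulrA.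
Qed.

(** * The blocks of the family *)

Definition EH_half : seq R :=
  [seq 1 + p%:R * a | a <- enum (Teich q xi)] ++ [:: p%:R].

(** Representatives of the orbits: multiplication by xi turns the block of
    squares into the block of non-squares. *)
Definition EH_reps : seq R := EH_half ++ [seq c * xi | c <- EH_half].

Lemma EH_orbits : EH p q xi = [seq dilate c (Tsquares q xi) | c <- EH_reps].
Proof.
rewrite /EH /EH_reps /EH_half !map_cat -!map_comp -!catA /=.
congr (_ ++ _ :: _); rewrite dilate_Tnonsquares; congr (_ ++ _).
by apply: eq_map => a /=; rewrite dilate_Tnonsquares.
Qed.

Lemma size_EH_reps : (size EH_reps * #|Tsquares q xi| = #|R| - 1)%N.
Proof.
rewrite card_Tsquares R_card size_cat size_map !size_cat size_map -cardE.
rewrite card_Teich /=.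
have -> : (q * q - 1 = (q + 1) * (q - 1))%N by nia.
by rewrite [in RHS]q1E addnn -muln2 -mulnA.
Qed.

(** An even power of xi lies in H; for an odd power, the extra factor xi is
    absorbed in the representative. *)
Lemma EH_half_covers c i : c \in EH_half ->
  exists2 d, d \in EH_reps & c * xi ^+ i \in dilate d (Tsquares q xi).
Proof.
move=> cE; rewrite -(odd_double_half i) -mul2n; case: (odd i).
  exists (c * xi); first by rewrite mem_cat [X in _ || X]map_f ?orbT.
  by rewrite add1n exprS mulrA; apply/imset_f/Tsquares_expr.
exists c; first by rewrite mem_cat cE.
by rewrite add0n; apply/imset_f/Tsquares_expr.
Qed.

Lemma EH_covers (x : R) : x != 0 ->
  exists2 c, c \in EH_reps & x \in dilate c (Tsquares q xi).
Proof.
have [a [b [aT bT ->]]] := Teich_decomp x.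
case: (TeichP aT) => [->|[i ->]] x0.
  rewrite add0r in x0 *; case: (TeichP bT) => [b0|[i ->]].
    by rewrite b0 mulr0 eqxx in x0.
  by apply: EH_half_covers; rewrite mem_cat inE eqxx orbT.
have [j xij] := xi_inv i.
have -> : xi ^+ i + p%:R * b = (1 + p%:R * (b * xi ^+ j)) * xi ^+ i.
  by rewrite mulrDl mul1r -!mulrA [xi ^+ j * _]mulrC xij mulr1.
apply: EH_half_covers; rewrite mem_cat; apply/orP; left.
apply: (map_f (fun a : R => 1 + p%:R * a)); rewrite mem_enum.
exact: TeichM bT (Teich_expr j).
Qed.

Lemma EH_difference_family :
  disjoint_difference_family (q * q) m ((q - 3) %/ 2) (EH p q xi)
  /\ near_complete (EH p q xi).
Proof.
have H_gt0 : (0 < #|Tsquares q xi|)%N by rewrite card_Tsquares; lia.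
have [E_card E_disj E_part] := dilates_partition H_gt0 size_EH_reps EH_covers.
rewrite -EH_orbits in E_card E_disj E_part.
split=> //; split=> //; split=> //.
  by move=> A /E_card->; exact: card_Tsquares.
have -> : ((q - 3) %/ 2 = #|Tsquares q xi| - 1)%N by rewrite card_Tsquares; lia.
apply: orbit_differences => //.
- exact: Tsquares1.
- exact: dilate_Tsquares.
- by move=> h k /Tsquares_Teich hT /Tsquares_Teich; apply: Teich_sep.
- by move=> A; rewrite EH_orbits => /mapP[c _ ->]; exists c.
Qed.
End TeichmullerSystem.

Theorem theorem3p4 (p r : nat) (f : {poly 'Z_(p ^ 2)}) (xi : GR f) :
  prime p -> odd p -> (0 < r)%N -> (5 <= p ^ r)%N ->
  galois_poly r f ->
  (p ^ r - 1).-primitive_root xi ->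
  disjoint_difference_family
    (p ^ (2 * r)) ((p ^ r - 1) %/ 2) ((p ^ r - 3) %/ 2) (EH p (p ^ r) xi)
  /\ near_complete (EH p (p ^ r) xi).
Proof.
move=> p_pr p_odd r_gt0 q_ge5 f_gal xi_prim.
rewrite mulnC expnM -mulnn; apply: EH_difference_family => //.
- exact: GR_sqr_p.
- exact: GR_p_neq0.
- exact: card_GR f_gal.
- exact: GR_local f_gal.
Qed.
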